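(* Let $\mathbf{e}$ be a transitive relation on a set $E$. The following are equivalent: (i) $\mathbf{e}$ is square-free; (ii) $\mathrm{Clop}(\mathbf{e})=\mathrm{Reg}(\mathbf{e})$; (iii) $\mathrm{Clop}(\mathbf{e})$ is a lattice; (iv) $\mathrm{Clop}(\mathbf{e})$ has the interpolation property: for all $\mathbf{x}_0,\mathbf{x}_1,\mathbf{y}_0,\mathbf{y}_1\in\mathrm{Clop}(\mathbf{e})$ such that $\mathbf{x}_i\subseteq\mathbf{y}_j$ for all $i,j\in\{0,1\}$, there exists $\mathbf{z}\in\mathrm{Clop}(\mathbf{e})$ with $\mathbf{x}_i\subseteq\mathbf{z}\subseteq\mathbf{y}_i$ for all $i\in\{0,1\}$.
   Context: A transitive relation $\mathbf{e}$ on $E$ is viewed as a set of ordered pairs. Write $x\lhd y$ if $(x,y)\in\mathbf{e}$ and $x\unlhd y$ if ($x\lhd y$ or $x=y$). For $a,b\in E$ let $[a,b]=\{x\in E: a\unlhd x\unlhd b\}$. $\mathbf{e}$ is square-free if for every $(a,b)\in\mathbf{e}$, any two elements $x,y\in[a,b]$ satisfy $x\unlhd y$ or $y\unlhd x$. A subset $\mathbf{a}\subseteq\mathbf{e}$ is closed if transitive, open if $\mathbf{e}\setminus\mathbf{a}$ is transitive, clopen if both. $\mathrm{cl}$ is transitive closure, $\mathrm{int}(\mathbf{a})$ the largest open subset of $\mathbf{a}$; $\mathbf{a}$ is regular closed if $\mathbf{a}=\mathrm{cl}(\mathrm{int}(\mathbf{a}))$. $\mathrm{Clop}(\mathbf{e})$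 (resp. $\mathrm{Reg}(\mathbf{e})$) is the set of clopen (resp. regular closed) subsets of $\mathbf{e}$ ordered by inclusion. *)

(* Defs.v *)
From Stdlib Require Import Relation_Operators.
From mathcomp Require Import all_boot.
From mathcomp Require Import all_classical.

Set Implicit Arguments.
Unset Strict Implicit.
Unset Printing Implicit Defensive.

Local Open Scope classical_set_scope.

Section Definitions.
Variable E : Type.
Implicit Types (e a : set (E * E)) (x y : E).

(* MathComp's [transitive] is about boolean relations. *)
Definition trans a : Prop :=
  forall x y z, a (x, y) -> a (y, z) -> a (x, z).

Definition tri_eq e x y : Prop := e (x, y) \/ x = y.

Definition segment e x y : set E := [set z | tri_eq e x z /\ tri_eq e z y].

Definition square_free e : Prop :=
  forall a b : E, e (a, b) -> forall x y, segment e a b x -> segment e a b y ->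
  tri_eq e x y \/ tri_eq e y x.

Definition is_closed e a : Prop := a `<=` e /\ trans a.

Definition is_open e a : Prop := a `<=` e /\ trans (e `\` a).

Definition tclosure a : set (E * E) :=
  [set p | clos_trans E (fun x y => a (x, y)) p.1 p.2].

(* This union is itself open, hence the largest open subset of [a]: see
   [interior_in_sub], [interior_in_open] and [interior_in_max]. *)
Definition interior_in e a : set (E * E) :=
  \bigcup_(u in [set u | is_open e u /\ u `<=` a]) u.

Definition is_regular_closed e a : Prop :=
  a `<=` e /\ a = tclosure (interior_in e a).

Definition Clop e : set (set (E * E)) :=
  [set a | is_closed e a /\ is_open e a].

Definition Reg e : set (set (E * E)) := [set a | is_regular_closed e a].

Lemma interior_in_sub e a : interior_in e a `<=` a.
Proof. by move=> p [u [_ ua] /ua]. Qed.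

Lemma interior_in_open e a : trans e -> is_open e (interior_in e a).
Proof.
move=> et; split=> [p [u [[ue _] _] /ue]//|x y z [exy nxy] [eyz nyz]].
split=> [|[u [uo ua] uxz]]; first exact: et exy eyz.
have [] : (e `\` u) (x, z); last by [].
by apply: (uo.2 x y z); split=> // up; [apply: nxy | apply: nyz]; exists u.
Qed.

Lemma interior_in_max e a u : is_open e u -> u `<=` a -> u `<=` interior_in e a.
Proof. by move=> uo ua p up; exists u. Qed.

End Definitions.

Section InclusionOrder.
Variables (T : Type) (P : set (set T)).
Implicit Types x y z : set T.

Definition is_join x y z : Prop :=
  [/\ P z, x `<=` z, y `<=` z &
      forall w, P w -> x `<=` w -> y `<=` w -> z `<=` w].

Definition is_meet x y z : Prop :=
  [/\ P z, z `<=` x, z `<=` y &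
      forall w, P w -> w `<=` x -> w `<=` y -> w `<=` z].

Definition is_lattice : Prop :=
  forall x y, P x -> P y ->
  (exists z, is_join x y z) /\ (exists z, is_meet x y z).

Definition interpolation : Prop :=
  forall x0 x1 y0 y1, P x0 -> P x1 -> P y0 -> P y1 ->
  x0 `<=` y0 -> x0 `<=` y1 -> x1 `<=` y0 -> x1 `<=` y1 ->
  exists z, [/\ P z, x0 `<=` z, x1 `<=` z, z `<=` y0 & z `<=` y1].

End InclusionOrder.

(* Main.v *)
(** If [e] is square-free, the closure of an open set [u] is open: when [y]
    lies between the ends of a [u]-chain, comparability of [y] with all the
    points of the chain puts [y] between two consecutive ones, and openness of
    [u] splits that link.  So [Reg e] is [Clop e].  Joins and meets always
    exist in [Reg e], and a join interpolates.  Conversely, any [U] defines a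
    clopen set [crossing e U], the pairs of [e] entering [U].  If [x] and [y]
    are incomparable in [segment e a b], then [crossing e [set x]] and
    [crossing e (~` [set x])] are contained in the complements in [e] of
    [crossing e [set y]] and [crossing e (~` [set y])]; an interpolant would
    contain [(a, x)] and [(x, b)], hence [(a, b)], hence [(a, y)] or
    [(y, b)], which is excluded. *)
Require Import Defs.
From Stdlib Require Import Relation_Operators Operators_Properties.
From mathcomp Require Import all_boot.
From mathcomp Require Import all_classical.

Local Open Scope classical_set_scope.

Section TransitiveRelation.
Context {E : Type}.
Implicit Types (e a u v w : set (E * E)) (U V : set E) (x y z : E).

Lemma tclosure_trans a : trans (tclosure a).
Proof. by move=> x y z; apply: t_trans. Qed.

Lemma sub_tclosure a : a `<=` tclosure a.
Proof. by move=> [x y] axy; apply: t_step. Qed.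

Lemma tclosure_min a w : trans w -> a `<=` w -> tclosure a `<=` w.
Proof.
move=> wt aw [x y]; rewrite /tclosure /=.
by elim=> [p q /aw//|p q r _ wpq _ wqr]; apply: wt wpq wqr.
Qed.

Lemma tclosureS a w : a `<=` w -> tclosure a `<=` tclosure w.
Proof.
move=> aw; apply: tclosure_min; first exact: tclosure_trans.
by move=> p /aw /sub_tclosure.
Qed.

Lemma is_openU e u v : is_open e u -> is_open e v -> is_open e (u `|` v).
Proof.
move=> [ue uo] [ve vo]; split=> [p [/ue|/ve]//|x y z [exy nxy] [eyz nyz]].
have [exz nu] : (e `\` u) (x, z).
  by apply: (uo x y z); split=> // h; [apply: nxy|apply: nyz]; left.
have [_ nv] : (e `\` v) (x, z).
  by apply: (vo x y z); split=> // h; [apply: nxy|apply: nyz]; right.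
by split=> // -[].
Qed.

Lemma is_open_split e u x y z : is_open e u -> u (x, z) ->
  e (x, y) -> e (y, z) -> u (x, y) \/ u (y, z).
Proof.
move=> [_ uo] uxz exy eyz.
have [uxy|nxy] := pselect (u (x, y)); first by left.
have [uyz|nyz] := pselect (u (y, z)); first by right.
by have [] := uo x y z (conj exy nxy) (conj eyz nyz).
Qed.

(** The open set [u] lies in the interior of its closure, so closing that interior gives back at
    least [tclosure u], and no more since [tclosure u] is transitive. *)
Lemma tclosure_regular e u : trans e -> is_open e u -> Reg e (tclosure u).
Proof.
move=> et uo; split; first exact: tclosure_min et uo.1.
apply/seteqP; split.
  by apply: tclosureS; apply: interior_in_max => //; apply: sub_tclosure.
by apply: tclosure_min; [apply: tclosure_trans|apply: interior_in_sub].
Qed.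

Lemma Clop_sub_Reg e : Clop e `<=` Reg e.
Proof.
move=> a [[ae at_] ao]; split=> //; apply/seteqP; split.
  by move=> p ap; apply: sub_tclosure; exists a => //; split.
by apply: tclosure_min => //; apply: interior_in_sub.
Qed.

(* Induction on the chain from [x] to [z]: only its start need be below [y]. *)
Lemma tclosure_split e u x y z : trans e -> square_free e -> is_open e u ->
  tclosure u (x, z) -> tri_eq e x y -> tri_eq e y z ->
  tclosure u (x, y) \/ tclosure u (y, z).
Proof.
move=> et sf uo /clos_trans_t1n_iff/=.
have cle p q : clos_trans_1n E (fun x y => u (x, y)) p q -> tclosure u (p, q).
  by move=> /clos_trans_t1n_iff.
(* The one-link case: if [y] is an end of the link, one half is the link itself; otherwise openness
   splits it. *)
have link p q : u (p, q) -> tri_eq e p y -> tri_eq e y q ->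
    tclosure u (p, y) \/ tclosure u (y, q).
  move=> upq [epy|<-]; last by right; apply: sub_tclosure.
  move=> [eyq|->]; last by left; apply: sub_tclosure.
  by have [h|h] := is_open_split _ _ _ _ _ uo upq epy eyq;
    [left|right]; apply: sub_tclosure.
elim=> [p q|p s q ups /cle csq IH py yq]; first exact: link.
have eps := uo.1 _ ups.
have esq : e (s, q) := tclosure_min _ _ et uo.1 _ csq.
(* Both [s] and [y] lie in [segment e p q]. If [s] is below [y], recurse on the rest of the chain;
   if [y] is below [s], split the first link. *)
have [||sy|ys] := sf p q (et _ _ _ eps esq) s y; first by split; left.
- by split.
- have [csy|cyq] := IH sy yq; last by right.
  by left; apply: tclosure_trans csy; apply: sub_tclosure.
- have [cpy|cys] := link _ _ ups py ys; first by left.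
  by right; apply: tclosure_trans cys csq.
Qed.

Lemma square_free_Clop_Reg e : trans e -> square_free e -> Clop e = Reg e.
Proof.
move=> et sf; apply/seteqP; split; first exact: Clop_sub_Reg.
move=> a [ae ->]; have io := interior_in_open a et.
have ce := tclosure_min _ _ et io.1.
split; first by split=> //; apply: tclosure_trans.
split=> // x y z [exy nxy] [eyz nyz]; split; first exact: et exy eyz.
move=> cxz; have [] // := tclosure_split _ _ _ y _ et sf io cxz; by left.
Qed.

Lemma Clop_Reg_lattice e : trans e -> Clop e = Reg e -> is_lattice (Clop e).
Proof.
move=> et eCR a b Ca Cb; split.
  exists (tclosure (a `|` b)); split.
  - by rewrite eCR; apply: tclosure_regular => //; apply: is_openU Ca.2 Cb.2.
  - by move=> p ap; apply: sub_tclosure; left.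
  - by move=> p bp; apply: sub_tclosure; right.
  - by move=> w [[_ wt] _] aw bw; apply: tclosure_min => // p [/aw|/bw].
exists (tclosure (interior_in e (a `&` b))); split.
- by rewrite eCR; apply: tclosure_regular => //; apply: interior_in_open.
- by apply: tclosure_min; [exact: Ca.1.2|move=> p /interior_in_sub[]].
- by apply: tclosure_min; [exact: Cb.1.2|move=> p /interior_in_sub[]].
(* A clopen lower bound is open, so it already lies in the interior of the intersection. *)
- move=> w [_ wo] wa wb p wp; apply: sub_tclosure.
  by exists w => //; split=> // q wq; split; [apply: wa|apply: wb].
Qed.

Definition crossing e U : set (E * E) :=
  [set p | e p /\ ~ U p.1 /\ U p.2].

(** Two consecutive pairs never both enter [U]. If [(x, z)] enters [U], an intermediate [y] makes
    [(x, y)] or [(y, z)] enter it, according to whether [y] is in [U]. *)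
Lemma crossing_Clop e U : trans e -> Clop e (crossing e U).
Proof.
move=> et; split; split; try by move=> p [].
  by move=> x y z [_ [_ Uy]] [_ [nUy _]].
move=> x y z [exy nxy] [eyz nyz]; split; first exact: et exy eyz.
move=> [_ /= [nUx Uz]]; have [Uy|nUy] := pselect (U y).
  by apply: nxy.
by apply: nyz.
Qed.

Lemma Clop_setD e a : trans e -> Clop e a -> Clop e (e `\` a).
Proof.
move=> et [[ae at_] [_ ao]]; split; split=> //; try by move=> p [].
by rewrite setDD (setIidr ae).
Qed.

Lemma crossing_disjoint e U V :
  (forall x y, e (x, y) -> U y -> V y -> U x \/ V x) ->
  crossing e U `<=` e `\` crossing e V.
Proof.
move=> UV [x y] [exy [nUx Uy]]; split=> // -[_ [nVx Vy]].
by have [] := UV x y exy Uy Vy.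
Qed.

End TransitiveRelation.

Lemma is_lattice_interpolation (T : Type) (P : set (set T)) :
  is_lattice P -> interpolation P.
Proof.
move=> L x0 x1 y0 y1 P0 P1 Q0 Q1 h00 h01 h10 h11.
have [[z [Pz z0 z1 zmin]] _] := L x0 x1 P0 P1.
by exists z; split=> //; apply: zmin.
Qed.

Lemma interpolation_square_free (E : Type) (e : set (E * E)) :
  trans e -> interpolation (Clop e) -> square_free e.
Proof.
move=> et I a b eab x y [ax xb] [ay yb].
have [//|/not_orP[nxy nyx]] := pselect (tri_eq e x y \/ tri_eq e y x).
(* Any coincidence among [a], [b], [x], [y] excluded here would make [x] and [y] comparable, so the
   bounds on them are strict. *)
have ax' : a <> x by move=> E0; apply: nxy; rewrite -E0.
have ay' : a <> y by move=> E0; apply: nyx; rewrite -E0.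
have xb' : x <> b by move=> E0; apply: nyx; rewrite E0.
have yb' : y <> b by move=> E0; apply: nxy; rewrite E0.
have xy : x <> y by move=> E0; apply: nxy; right.
have {}ax : e (a, x) by case: ax.
have {}ay : e (a, y) by case: ay.
have {}xb : e (x, b) by case: xb.
have {}yb : e (y, b) by case: yb.
pose C := crossing e.
have [||||||||z [[[_ zt] zo] z0 z1 z0' z1']] := I (C [set x]) (C (~` [set x]))
    (e `\` C [set y]) (e `\` C (~` [set y])).
- exact: crossing_Clop.
- exact: crossing_Clop.
- by apply: Clop_setD => //; apply: crossing_Clop.
- by apply: Clop_setD => //; apply: crossing_Clop.
- by apply: crossing_disjoint => p q _ -> /xy.
(* In the mixed cases, a common pair would be [(y, x)] or, in the next one, [(x, y)]. *)
- apply: crossing_disjoint => p q epq /= qx _; right=> py.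
  by apply: nyx; left; rewrite -py -qx.
- apply: crossing_disjoint => p q epq /= _ qy; left=> px.
  by apply: nxy; left; rewrite -px -qy.
- apply: crossing_disjoint => p q _ _ _ /=.
  by have [->|] := pselect (p = x); [right|left].
have zab : z (a, b).
  apply: (zt a x b); first by apply: z0.
  by apply: z1; split=> //; split=> /=; [apply|move=> bx; apply: xb'].
have [/z0'[_ []]//|/z1'[_ []]] := is_open_split _ _ _ _ _ zo zab ay yb.
by split=> //; split=> /=; [apply|move=> by_; apply: yb'].
Qed.

Theorem theorem4p3 (E : Type) (e : set (E * E)) (e_trans : trans e) :
  [<-> square_free e;
       Clop e = Reg e;
       is_lattice (Clop e);
       interpolation (Clop e)].
Proof.
tfae.
- exact: square_free_Clop_Reg.
- exact: Clop_Reg_lattice.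
- exact: is_lattice_interpolation.
- exact: interpolation_square_free.
Qed.
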